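(* Let $\lambda\ge 0$ be a fixed constant, and for $\gamma\ge 0$ consider the problem $$\max_{S_i,E_i}\Big\{\gamma\cdot(E_1-E_2)+\sum_{i=1}^{2}\big(S_i-\lambda\, W(S_i,E_i)\big) : (S_i,E_i)\in\mathcal{O},\ i=1,2\Big\}.$$ The maximizers converge: $$\lim_{\gamma\to\infty}\underline{S}_1^*(\gamma)=\lim_{\gamma\to\infty}\overline{S}_1^*(\gamma)=S^4,\qquad \lim_{\gamma\to\infty}\underline{E}_1^*(\gamma)=\lim_{\gamma\to\infty}\overline{E}_1^*(\gamma)=E^{\text{max}},$$ $$\lim_{\gamma\to\infty}\underline{S}_2^*(\gamma)=\lim_{\gamma\to\infty}\overline{S}_2^*(\gamma)=S^{\text{min}},\qquad \lim_{\gamma\to\infty}\underline{E}_2^*(\gamma)=\lim_{\gamma\to\infty}\overline{E}_2^*(\gamma)=E^{\text{min}}.$$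
   Context: Superscripts are labels, not powers; subscripts $1,2$ denote time periods. $\mathcal{O}\subset\mathbb{R}^2$ (the set of feasible operating points $(S,E)$, where $S$ is satisfaction and $E$ is energy usage) is a compact, possibly nonconvex, polygonal region. $S^{\text{min}},S^{\text{max}}$ and $E^{\text{min}},E^{\text{max}}$ are the minimum and maximum of the $S$- and $E$-coordinates over $\mathcal{O}$. The points $(S^{\text{min}},E^{\text{min}})$, $(S^{\text{max}},E^{\text{opt}})$, $(S^{\text{max}},E^3)$, $(S^4,E^{\text{max}})$ form the right boundary of $\mathcal{O}$: the polygonal chain joining them successively by straight segments is contained in $\mathcal{O}$, and for each $E\in[E^{\text{min}},E^{\text{max}}]$ the largest $S$ with $(S,E)\in\mathcal{O}$ is the $S$-coordinate of the point on this chain at height $E$. Here $S^{\text{min}}<S^{\text{max}}$, $S^4<S^{\text{max}}$ and $E^{\text{min}}<E^{\text{opt}}\le E^3<E^{\text{max}}$. The chain runs from the lowest point to the topmost point of $\mathcal{O}$: $(S^{\text{min}},E^{\text{min}})$ is the only point of $\mathcal{O}$ with $E=E^{\text{min}}$, and $(S^4,E^{\text{max}})$ is the only point of $\mathcal{O}$ with $E=E^{\text{max}}$. The work function $W:\mathcal{O}\to[0,1]$ is continuous. It has exactly two global minimizers $(S^\alpha,E^\alpha),(S^\omega,E^\omega)\in\mathrm{int}(\mathcal{O})$ (at which its values are equal), with $S^\alpha<S^\omega$ and $E^\alpha<E^\omega$. For each $i\in\{1,2\}$, $S_i^*(\gamma)$ and $E_i^*(\gamma)$ are the projections of the set of maximizers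 of the problem onto the $S_i$- and $E_i$-components; overlines and underlines denote the maximum and minimum of these sets. *)

(* Defs.v *)
From HB Require Import structures.
From mathcomp Require Import all_boot all_order all_algebra.
From mathcomp Require Import all_classical all_reals all_analysis.
Set Implicit Arguments.
Unset Strict Implicit.
Unset Printing Implicit Defensive.
Import Order.TTheory GRing.Theory Num.Theory.
Import numFieldNormedType.Exports.
Local Open Scope classical_set_scope.
Local Open Scope ring_scope.



Section Extrema.
Context {R : realType}.

Definition is_min (A : set R) (m : R) : Prop := A m /\ lbound A m.
Definition is_max (A : set R) (m : R) : Prop := A m /\ ubound A m.

(* Meaningful only when the extremum is attained; otherwise an unspecified
   real number. *)
Definition set_min (A : set R) : R := get (is_min A).
Definition set_max (A : set R) : R := get (is_max A).

Definition minimizers {T : Type} (D : set T) (f : T -> R) : set T :=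
  [set x | D x /\ forall y, D y -> f x <= f y].
Definition maximizers {T : Type} (D : set T) (f : T -> R) : set T :=
  [set x | D x /\ forall y, D y -> f y <= f x].

End Extrema.

(* Points of the plane are pairs (S, E) in R * R, with the product topology. *)
Section PlaneGeometry.
Context {R : realType}.
Implicit Types a b c p : (R * R)%type.

Definition plane_segment a b : set (R * R) :=
  [set p | exists t : R, [/\ 0 <= t, t <= 1,
     p.1 = (1 - t) * a.1 + t * b.1 & p.2 = (1 - t) * a.2 + t * b.2]].

Fixpoint polygonal_chain (s : seq (R * R)) : set (R * R) :=
  match s with
  | a :: ((b :: _) as s') => plane_segment a b `|` polygonal_chain s'
  | _ => set0
  end.

Definition triangle (t : (R * R) * (R * R) * (R * R)) : set (R * R) :=
  let: (a, b, c) := t in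
  [set p | exists u v w : R, [/\ 0 <= u, 0 <= v, 0 <= w, u + v + w = 1 &
     p = (u * a.1 + v * b.1 + w * c.1, u * a.2 + v * b.2 + w * c.2)]].

Definition nondegenerate (t : (R * R) * (R * R) * (R * R)) : Prop :=
  let: (a, b, c) := t in
  (b.1 - a.1) * (c.2 - a.2) - (b.2 - a.2) * (c.1 - a.1) != 0.

(* A union of finitely many triangular regions. The triangles may overlap:
   subdividing them gives an ordinary triangulation of the same set. Neither
   convexity nor (simple) connectedness is imposed. *)
Definition polygonal_region (O : set (R * R)) : Prop :=
  exists2 ts : seq ((R * R) * (R * R) * (R * R)),
    (forall t, t \in ts -> nondegenerate t) &
    O = [set p | exists2 t, t \in ts & triangle t p].

End PlaneGeometry.

Section TwoPeriodProblem.
Context {R : realType}.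
Variables (O : set (R * R)) (W : R * R -> R) (lambda gamma : R).

(* A plan ((S_1, E_1), (S_2, E_2)) lists the operating points of periods 1
   and 2. *)
Definition objective (x : (R * R) * (R * R)) : R :=
  let: ((S1, E1), (S2, E2)) := x in
  gamma * (E1 - E2)
  + ((S1 - lambda * W (S1, E1)) + (S2 - lambda * W (S2, E2))).

Definition optimal_plans : set ((R * R) * (R * R)) :=
  maximizers (O `*` O) objective.

Definition S1_star : set R := [set x.1.1 | x in optimal_plans].
Definition E1_star : set R := [set x.1.2 | x in optimal_plans].
Definition S2_star : set R := [set x.2.1 | x in optimal_plans].
Definition E2_star : set R := [set x.2.2 | x in optimal_plans].

End TwoPeriodProblem.

(* Main.v *)
(* For large gamma the term gamma (E1 - E2) dominates. On O x O, E1 - E2 is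
   maximal only at the plan ((S4, Emax), (Smin, Emin)), because Emax and Emin are
   each attained at a single point of O; by compactness all optimal plans are
   then forced into any given neighbourhood of this plan. *)

Require Import Defs.
From HB Require Import structures.
From mathcomp Require Import all_boot all_order all_algebra.
From mathcomp Require Import all_classical all_reals all_analysis.
From mathcomp Require Import lra.
Import Order.TTheory GRing.Theory Num.Theory.
Import numFieldNormedType.Exports.
Local Open Scope classical_set_scope.
Local Open Scope ring_scope.

(* If a maximizer stays outside the open set V, then by compactness its value
   of g falls short of the maximum by a fixed gap; scaled by a large gamma,
   this gap exceeds the oscillation of h. *)
Lemma near_maximizers_sub {R : realType} {T : topologicalType} {K V : set T}
    {g h : T -> R} {p : T} :
  compact K -> {within K, continuous g} -> {within K, continuous h} ->
  maximizers K g = [set p] -> open V -> V p ->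
  \forall gamma \near +oo, maximizers K (fun x => gamma * g x + h x) `<=` V.
Proof.
move=> Kc gc hc gp oV Vp.
have [Kp gmax] : maximizers K g p by rewrite gp.
have [c1 _ hle] : exists2 c, c \in K & forall t, t \in K -> h t <= h c.
  by apply: compact_EVT_max => //; exists p.
(* The extreme value theorem needs a nonempty set, so the case where [V] covers [K] is settled
   separately. *)
have [KV0|/set0P KVn0] := eqVneq (K `&` ~` V) set0.
  apply: nearW => gamma x [Kx _]; apply: contrapT => nVx.
  have : (K `&` ~` V) x by [].
  by rewrite KV0.
have KVc : compact (K `&` ~` V) by apply: compact_closedI => //; exact: open_closedC.
have [c /set_mem[Kc' nVc] gle] : exists2 c, c \in K `&` ~` V &
    forall t, t \in K `&` ~` V -> g t <= g c.
  by apply: compact_EVT_max => //; apply: continuous_subspaceW gc => x [].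
(* Equality would make [c] a second maximizer of [g], although [p] is the only one and lies in
   [V]. *)
have gap : 0 < g p - g c.
  rewrite subr_gt0 lt_neqAle gmax // andbT; apply/eqP => gcp; apply: nVc.
  suff -> : c = p by [].
  have : maximizers K g c by split => // y /gmax; rewrite gcp.
  by rewrite gp.
near=> gamma => x [Kx /(_ _ Kp) xmax]; apply: contrapT => nVx.
have gx : g x <= g c by apply: gle; rewrite inE.
have hx : h x <= h c1 by apply: hle; rewrite inE.
have gamma0 : 0 <= gamma by near: gamma; apply: nbhs_pinfty_ge; exact: num_real.
(* Optimality of [x] against [p] gives [gamma * g p + h p <= gamma * g c + h c1]. This threshold is
   exactly where that inequality starts to fail. *)
have : (h c1 - h p) / (g p - g c) < gamma.
  by near: gamma; apply: nbhs_pinfty_gt; exact: num_real.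
rewrite ltr_pdivrMr // mulrBr => big.
have := ler_wpM2l gamma0 gx; lra.
Unshelve. all: by end_near. Qed.

Lemma maximizers_nonempty (R : realType) (T : topologicalType) (K : set T)
    (f : T -> R) :
  K !=set0 -> compact K -> {within K, continuous f} -> maximizers K f !=set0.
Proof.
move=> K0 Kc fc; have [c /set_mem Kcc fle] := compact_EVT_max K0 Kc fc.
by exists c; split => // y Ky; apply: fle; rewrite inE.
Qed.

(** Once a maximizer [c] exists, the maximizers form the superlevel set of [f] at height [f c],
    which is closed relative to [K]. *)
Lemma compact_maximizers (R : realType) (T : topologicalType) (K : set T)
    (f : T -> R) :
  compact K -> {within K, continuous f} -> compact (maximizers K f).
Proof.
move=> Kc fc; have [->|/set0P[c [Kcc cmax]]] := eqVneq (maximizers K f) set0.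
  exact: compact0.
have /closed_subspaceP[V cV VK] : closed ((f : subspace K -> R) @^-1` [set y | f c <= y]).
  by apply: preimage_closed => //; exact: closed_ge.
suff -> : maximizers K f = K `&` V by exact: compact_closedI.
rewrite setIC VK; apply/seteqP; split => x /=.
  by move=> [Kx xmax]; split => //; exact: xmax.
by move=> [cx Kx]; split => // y /cmax /le_trans; apply.
Qed.

Lemma image_extrema (R : realType) (T : topologicalType) (A : set T)
    (q : T -> R) :
  A !=set0 -> compact A -> continuous q ->
  (exists m, is_min (q @` A) m) /\ (exists M, is_max (q @` A) M).
Proof.
move=> A0 Ac /(@continuous_subspaceT _ _ A) qc; split.
  have [c /set_mem Acc cle] := compact_EVT_min A0 Ac qc.
  exists (q c); split; first by exists c.
  by move=> _ [x Ax <-]; apply: cle; rewrite inE.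
have [c /set_mem Acc cle] := compact_EVT_max A0 Ac qc.
exists (q c); split; first by exists c.
by move=> _ [x Ax <-]; apply: cle; rewrite inE.
Qed.

Lemma set_minP {R : realType} {A : set R} :
  (exists m, is_min A m) -> is_min A (set_min A).
Proof. exact: getPex. Qed.

Lemma set_maxP {R : realType} {A : set R} :
  (exists m, is_max A m) -> is_max A (set_max A).
Proof. exact: getPex. Qed.

(** If the sets [A gamma] shrink to [p], any choice of a value of [q] on them tends to [q p]. The
    minimum and the maximum of a projection are both such choices. *)
Lemma cvg_image_selection {R : realType} {T U : topologicalType}
    {F : set_system R} {A : R -> set T} {q : T -> U} {u : R -> U} {p : T}
    {FF : Filter F} :
  continuous q ->
  (forall V, open V -> V p -> \forall gamma \near F, A gamma `<=` V) ->
  (\forall gamma \near F, (q @` A gamma) (u gamma)) ->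
  u gamma @[gamma --> F] --> q p.
Proof.
move=> qc Ap uA X /qc; rewrite nbhsE => -[V [oV Vp] VX].
have := Ap _ oV Vp; apply: filterS2 uA => gamma [x Ax qx] AV /=.
by rewrite -qx; apply: VX; exact: AV.
Qed.

(** This transfers the continuity of [W], known only relative to [O], to the product [O * O] through
    the two projections. *)
Lemma within_continuous_comp_in {X Y Z : topologicalType} {A : set X}
    {B : set Y} {f : X -> Y} {g : Y -> Z} :
  continuous f -> (forall x, A x -> B (f x)) -> {within B, continuous g} ->
  {within A, continuous (g \o f)}.
Proof.
move=> fc AB /subspace_continuousP gc; apply/subspace_continuousP => x Ax.
move=> U /(gc _ (AB _ Ax)) gU.
have : \forall y \near x, B (f y) -> U (g (f y)) by exact: fc gU.
by apply: filterS => y BU Ay; apply: BU; exact: AB.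
Qed.

Theorem proposition6 (R : realType)
  (* feasible operating points *)
  (O : set (R * R)) (hOcompact : compact O) (hOpoly : polygonal_region O)
  (Smin Smax Emin Emax Eopt E3 S4 : R)
  (hSmin : is_min [set p.1 | p in O] Smin)
  (hSmax : is_max [set p.1 | p in O] Smax)
  (hEmin : is_min [set p.2 | p in O] Emin)
  (hEmax : is_max [set p.2 | p in O] Emax)
  (* right boundary *)
  (hchainO : polygonal_chain
     [:: (Smin, Emin); (Smax, Eopt); (Smax, E3); (S4, Emax)] `<=` O)
  (hright : forall S E : R, Emin <= E -> E <= Emax ->
     polygonal_chain
       [:: (Smin, Emin); (Smax, Eopt); (Smax, E3); (S4, Emax)] (S, E) ->
     is_max [set S' | O (S', E)] S)
  (hSminmax : Smin < Smax) (hS4 : S4 < Smax)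
  (hEminopt : Emin < Eopt) (hEopt3 : Eopt <= E3) (hE3max : E3 < Emax)
  (hbottom : [set p | O p /\ p.2 = Emin] = [set (Smin, Emin)])
  (htop : [set p | O p /\ p.2 = Emax] = [set (S4, Emax)])
  (* work function *)
  (W : R * R -> R)
  (hW01 : forall p, O p -> 0 <= W p /\ W p <= 1)
  (hWcont : {within O, continuous W})
  (Salpha Ealpha Somega Eomega : R)
  (hWmin : minimizers O W = [set (Salpha, Ealpha); (Somega, Eomega)])
  (halpha : interior O (Salpha, Ealpha))
  (homega : interior O (Somega, Eomega))
  (hSao : Salpha < Somega) (hEao : Ealpha < Eomega)
  (lambda : R) (hlambda : 0 <= lambda) :
  (* the minima and maxima of the projections exist *)
  (forall gamma : R, 0 <= gamma ->
     forall A : set R,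
       A = S1_star O W lambda gamma \/ A = E1_star O W lambda gamma \/
       A = S2_star O W lambda gamma \/ A = E2_star O W lambda gamma ->
     (exists m : R, is_min A m) /\ (exists M : R, is_max A M)) /\
  (* and they converge *)
  (set_min (S1_star O W lambda gamma) @[gamma --> +oo] --> S4 /\
   set_max (S1_star O W lambda gamma) @[gamma --> +oo] --> S4) /\
  (set_min (E1_star O W lambda gamma) @[gamma --> +oo] --> Emax /\
   set_max (E1_star O W lambda gamma) @[gamma --> +oo] --> Emax) /\
  (set_min (S2_star O W lambda gamma) @[gamma --> +oo] --> Smin /\
   set_max (S2_star O W lambda gamma) @[gamma --> +oo] --> Smin) /\
  (set_min (E2_star O W lambda gamma) @[gamma --> +oo] --> Emin /\
   set_max (E2_star O W lambda gamma) @[gamma --> +oo] --> Emin).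
Proof.
set K := O `*` O.
(* The objective is split into the part [g] that [gamma] scales and a remainder [h] independent of
   [gamma]. *)
pose g (x : (R * R) * (R * R)) := x.1.2 - x.2.2.
pose h (x : (R * R) * (R * R)) :=
  (x.1.1 - lambda * W x.1) + (x.2.1 - lambda * W x.2).
have objE gamma : objective W lambda gamma = fun x => gamma * g x + h x.
  by apply/funext => -[[S1 E1] [S2 E2]].
have c11 : continuous (fun x : (R * R) * (R * R) => x.1.1).
  by move=> x; apply: continuous_comp; exact: cvg_fst.
have c12 : continuous (fun x : (R * R) * (R * R) => x.1.2).
  by move=> x; apply: continuous_comp; [exact: cvg_fst|exact: cvg_snd].
have c21 : continuous (fun x : (R * R) * (R * R) => x.2.1).
  by move=> x; apply: continuous_comp; [exact: cvg_snd|exact: cvg_fst].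
have c22 : continuous (fun x : (R * R) * (R * R) => x.2.2).
  by move=> x; apply: continuous_comp; exact: cvg_snd.
have Kc : compact K by exact: compact_setX.
have gc : continuous g by move=> x; apply: cvgB; [exact: c12|exact: c22].
have gcK : {within K, continuous g} by exact: continuous_subspaceT.
have W1c : {within K, continuous (fun x => W x.1)}.
  by apply: within_continuous_comp_in hWcont; [move=> x; exact: cvg_fst|move=> x []].
have W2c : {within K, continuous (fun x => W x.2)}.
  by apply: within_continuous_comp_in hWcont; [move=> x; exact: cvg_snd|move=> x []].
have hcK : {within K, continuous h}.
  move=> x; apply: cvgD; apply: cvgB.
  - exact: (continuous_subspaceT c11).
  - by apply: cvgMr; exact: W1c.
  - exact: (continuous_subspaceT c21).
  - by apply: cvgMr; exact: W2c.
have fcK gamma : {within K, continuous (objective W lambda gamma)}.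
  rewrite objE => x; apply: cvgD; last exact: hcK.
  by apply: cvgMr; exact: gcK.
have [Obot _] : O (Smin, Emin) /\ Emin = Emin.
  by have : [set (Smin, Emin)] (Smin, Emin) by []; rewrite -hbottom.
have [Otop _] : O (S4, Emax) /\ Emax = Emax.
  by have : [set (S4, Emax)] (S4, Emax) by []; rewrite -htop.
have Emin_le x : O x -> Emin <= x.2 by move=> Ox; apply: hEmin.2; exists x.
have Emax_ge x : O x -> x.2 <= Emax by move=> Ox; apply: hEmax.2; exists x.
pose p := ((S4, Emax), (Smin, Emin)).
(* Comparison with [p] gives [Emax - Emin <= x.2 - y.2]. With the bounds on the heights this forces
   [x.2 = Emax] and [y.2 = Emin], and each of these heights is attained at one point only. *)
have gmax : maximizers K g = [set p].
  apply/seteqP; split => [[x y] [[/= Ox Oy] /(_ p)]|_ ->].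
    rewrite /g /= => /(_ (conj Otop Obot)) xy.
    have := Emax_ge _ Ox; have := Emin_le _ Oy => y2 x2.
    have : [set (S4, Emax)] x by rewrite -htop; split => //; lra.
    have : [set (Smin, Emin)] y by rewrite -hbottom; split => //; lra.
    by move=> -> ->.
  split => // -[x y] [/= Ox Oy]; rewrite /g /=.
  by have := Emax_ge _ Ox; have := Emin_le _ Oy; lra.
have optE (q : (R * R) * (R * R) -> R) : continuous q -> forall gamma,
    (exists m, is_min (q @` optimal_plans O W lambda gamma) m) /\
    (exists m, is_max (q @` optimal_plans O W lambda gamma) m).
  move=> qc gamma; apply: image_extrema => //; last exact: compact_maximizers.
  by apply: maximizers_nonempty => //; exists p.
have optcvg V : open V -> V p ->
    \forall gamma \near +oo, optimal_plans O W lambda gamma `<=` V.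
  move=> oV Vp; have := near_maximizers_sub Kc gcK hcK gmax oV Vp.
  by apply: filterS => gamma; rewrite /optimal_plans objE.
(* An attained extremum belongs to the projected set, so it is a selection. The four coordinates of
   [p] then supply the limits [S4], [Emax], [Smin] and [Emin]. *)
have lims (q : (R * R) * (R * R) -> R) : continuous q ->
    set_min (q @` optimal_plans O W lambda gamma) @[gamma --> +oo] --> q p /\
    set_max (q @` optimal_plans O W lambda gamma) @[gamma --> +oo] --> q p.
  move=> qc; split; apply: (cvg_image_selection qc optcvg); apply: nearW => gamma.
    exact: (set_minP (optE q qc gamma).1).1.
  exact: (set_maxP (optE q qc gamma).2).1.
split; last by split; [exact: lims c11|split; [exact: lims c12|
  split; [exact: lims c21|exact: lims c22]]].
by move=> gamma _ A [->|[->|[->|->]]]; exact: optE.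
Qed.
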